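(* Let $n\ge 3$ and let $g=\sum_{i=1}^n dx_i^2$ be the Euclidean metric on $\mathbb{R}^n$ with coordinates $x=(x_1,\dots,x_n)$. Let $f_1,\dots,f_n:\mathbb{R}^n\to\mathbb{R}$ be smooth functions such that $3f_i(x)+f_j(x)\neq 0$ for all $x\in\mathbb{R}^n$ and all $i\neq j$. Put $T=\sum_{i=1}^n f_i\,dx_i^2$ and $R=T\odot g$. Fix an index $m\in\{1,\dots,n\}$. Then there exists a positive smooth function $\varphi$ on $\mathbb{R}^n$ such that the metric $\bar g=\frac{1}{\varphi^2}g$ has Riemannian curvature tensor $\bar R=R$ if and only if the functions $f_i$ satisfy the following system on $\mathbb{R}^n$: (1) $\displaystyle \frac{f_{i,x_j}}{3f_i+f_j}=\frac{f_{k,x_j}}{3f_k+f_j}$ for all $i\neq j$, $k\neq j$; (2) $\displaystyle \left(\frac{f_{j,x_i}}{3f_j+f_i}\right)_{,x_k}=\left(\frac{f_{j,x_k}}{3f_j+f_k}\right)_{,x_i}$ for all $i\neq j$, $k\neq j$; (3) $\displaystyle \left(\frac{f_{i,x_j}}{3f_i+f_j}\right)_{,x_i}=\left(\frac{f_{j,x_i}}{3f_j+f_i}\right)_{,x_j}$ for all $i\neq j$; (4) $\displaystyle \frac12\left(\frac{f_{j,x_i}}{3f_j+f_i}\right)^2-\left(\frac{f_{j,x_i}}{3f_j+f_i}\right)_{,x_i}-\frac12\sum_{k\neq i}\left(\frac{f_{\ell(k),x_k}}{3f_{\ell(k)}+f_k}\right)^2=h_i$ for all $i\neq j$, where for each $k$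 the index $\ell(k)$ is any index different from $k$ (by (1) the quotient does not depend on its choice); (5) $\displaystyle \frac{f_{j,x_i}}{3f_j+f_i}\cdot\frac{f_{i,x_j}}{3f_i+f_j}=\left(\frac{f_{i,x_j}}{3f_i+f_j}\right)_{,x_i}$ for all $i\neq j$; where $$h_i=f_i\,\exp\left(2\left(-\int\frac{f_{l,x_m}}{3f_l+f_m}\,dx_m+\psi\right)\right)$$ with $l$ any index different from $m$, and $\psi$ is some smooth function on $\mathbb{R}^n$ that does not depend on $x_m$ and satisfies the $n-1$ equations $$\psi_{,x_i}=\int\left(\frac{f_{i,x_m}}{3f_i+f_m}\right)_{,x_i}dx_m-\frac{f_{m,x_i}}{3f_m+f_i},\qquad i\neq m.$$ In that case, up to a multiplicative constant, $$\varphi(x)=\exp\left(-\int\frac{f_{l,x_m}}{3f_l+f_m}\,dx_m+\psi\right),\qquad l\neq m.$$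
   Context: Notation: $f_{i,x_j}$ and $(\cdot)_{,x_k}$ denote partial derivatives with respect to $x_j$, $x_k$. For symmetric $(0,2)$-tensors $h,k$ the Kulkarni–Nomizu product is $(h\odot k)(X,Y,Z,W)=h(X,Z)k(Y,W)+h(Y,W)k(X,Z)-h(X,W)k(Y,Z)-h(Y,Z)k(X,W)$. The Riemannian curvature $(0,4)$-tensor of a metric is taken with the sign convention for which a metric $\tilde g$ of constant sectional curvature $c$ has curvature tensor $\frac{c}{2}\,\tilde g\odot\tilde g$; equivalently $R_{\tilde g}=W_{\tilde g}+A_{\tilde g}\odot \tilde g$, where $W_{\tilde g}$ is the Weyl tensor and $A_{\tilde g}=\frac{1}{n-2}\left(\mathrm{Ric}_{\tilde g}-\frac{K_{\tilde g}}{2(n-1)}\tilde g\right)$ is the Schouten tensor, $K_{\tilde g}$ being the scalar curvature. The indefinite integral $\int(\cdot)\,dx_m$ denotes one fixed smooth function $P$ on $\mathbb{R}^n$ with $P_{,x_m}=\frac{f_{l,x_m}}{3f_l+f_m}$ (the same $P$ wherever it appears), and $\int\left(\frac{f_{i,x_m}}{3f_i+f_m}\right)_{,x_i}dx_m$ denotes $P_{,x_i}$. *)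

(* Defs.v *)
From mathcomp Require Export all_boot all_order all_algebra.
From mathcomp Require Export all_classical all_reals all_analysis.

Set Implicit Arguments.
Unset Strict Implicit.
Unset Printing Implicit Defensive.

Export Order.TTheory GRing.Theory Num.Theory.
Export numFieldNormedType.Exports.

#[global] Open Scope ring_scope.

Section Definitions.
Context {R : realType} {n : nat}.

Local Notation E := ('rV[R]_n).

Definition pd (i : 'I_n) (F : E -> R) : E -> R :=
  fun x => 'D_('e_i) F x.

Definition smooth (F : E -> R) : Prop :=
  forall s : seq 'I_n,
    continuous (foldr pd F s) /\
    forall (i : 'I_n) (x : E), derivable (foldr pd F s) x 'e_i.

(* Tensor fields are given by their components in the coordinate frame
   d/dx_1, ..., d/dx_n: a (0,2)-tensor field is a map E -> 'M[R]_n, a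
   (0,4)-tensor at a point is a map 'I_n -> 'I_n -> 'I_n -> 'I_n -> R. *)

Definition kulkarni_nomizu (h k : 'M[R]_n) (a b c d : 'I_n) : R :=
  h a c * k b d + h b d * k a c - h a d * k b c - h b c * k a d.

(* christoffel G k i j x is the symbol with upper index k and lower indices
   i, j. *)
Definition christoffel (G : E -> 'M[R]_n) (k i j : 'I_n) : E -> R := fun x =>
  2^-1 * \sum_(p < n) invmx (G x) k p *
    (pd i (fun y => G y j p) x + pd j (fun y => G y i p) x
     - pd p (fun y => G y i j) x).

(* The p-th component of R(d_i, d_j) d_l, where
   R(X, Y) = nabla_X nabla_Y - nabla_Y nabla_X - nabla_[X, Y]. *)
Definition curvature_endo (G : E -> 'M[R]_n) (i j l p : 'I_n) : E -> R :=
  fun x =>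
  pd i (christoffel G p j l) x - pd j (christoffel G p i l) x
  + \sum_(q < n) (christoffel G p i q x * christoffel G q j l x
                  - christoffel G p j q x * christoffel G q i l x).

(* R(X, Y, Z, W) = G(R(X, Y) W, Z): with this sign, constant sectional
   curvature c gives the tensor (c / 2) (G kulkarni_nomizu G). *)
Definition riemann (G : E -> 'M[R]_n) (x : E) (a b c d : 'I_n) : R :=
  \sum_(p < n) G x c p * curvature_endo G a b d p x.

Definition euclidean : E -> 'M[R]_n := fun=> 1%:M.

Definition conformal (phi : E -> R) : E -> 'M[R]_n :=
  fun x => (1 / phi x ^+ 2) *: euclidean x.

Definition diag_tensor (f : 'I_n -> E -> R) : E -> 'M[R]_n :=
  fun x => diag_mx (\row_i f i x).

Definition conformal_solution (f : 'I_n -> E -> R) (phi : E -> R) : Prop :=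
  [/\ smooth phi, (forall x, 0 < phi x) &
      forall x a b c d,
        riemann (conformal phi) x a b c d =
        kulkarni_nomizu (diag_tensor f x) (euclidean x) a b c d].

(* quo f i j is f_{i,x_j} / (3 f_i + f_j). *)
Definition quo (f : 'I_n -> E -> R) (i j : 'I_n) : E -> R :=
  fun x => pd j (f i) x / (3 * f i x + f j x).

Definition depends_not_on (m : 'I_n) (psi : E -> R) : Prop :=
  forall x y : E, (forall i, i != m -> x 0 i = y 0 i) -> psi x = psi y.

(* P stands for the fixed antiderivative with respect to x_m. *)
Definition psi_condition (f : 'I_n -> E -> R) (m : 'I_n) (P psi : E -> R) :
    Prop :=
  [/\ smooth psi, depends_not_on m psi &
      forall i, i != m -> forall x, pd i psi x = pd i P x - quo f m i x].

Definition phi_of (P psi : E -> R) : E -> R := fun x => expR (- P x + psi x).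

Definition h_of (f : 'I_n -> E -> R) (P psi : E -> R) (i : 'I_n) : E -> R :=
  fun x => f i x * expR (2 * (- P x + psi x)).

Definition pde_system (f h : 'I_n -> E -> R) : Prop :=
  [/\ forall i j k, i != j -> k != j -> forall x, quo f i j x = quo f k j x,
      forall i j k, i != j -> k != j ->
        forall x, pd k (quo f j i) x = pd i (quo f j k) x,
      forall i j, i != j -> forall x, pd i (quo f i j) x = pd j (quo f j i) x,
      forall ell : 'I_n -> 'I_n, (forall k, ell k != k) ->
        forall i j, i != j -> forall x,
        1 / 2 * quo f j i x ^+ 2 - pd i (quo f j i) x
        - 1 / 2 * \sum_(k < n | k != i) quo f (ell k) k x ^+ 2 = h i x
    & forall i j, i != j ->
        forall x, quo f j i x * quo f i j x = pd i (quo f i j) x].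

End Definitions.

(* Main.v *)
Require Import Defs.
From mathcomp Require Import ring lra.

Set Implicit Arguments.
Unset Strict Implicit.
Unset Printing Implicit Defensive.

(* With v_i = phi_{,i} / phi, the curvature of phi^{-2} g is phi^{-2} (S kn g),
   where S_ij = v_{j,i} + v_i v_j - |v|^2 delta_ij / 2 = phi_{,ij} / phi
   - |v|^2 delta_ij / 2 is its Schouten tensor.  As n >= 3, the equation
   R = T kn g therefore means S = phi^2 T, that is, phi_{,ij} = 0 for i != j and
   S_ii = phi^2 f_i.  Differentiating phi phi_{,ii} - |grad phi|^2 / 2 = phi^4 f_i
   along x_j and eliminating phi_{,ii} - phi_{,jj} = phi^3 (f_i - f_j) gives
   v_j = - f_{i,j} / (3 f_i + f_j); with these values of v, equations (4) and (5)
   are S = phi^2 T, and psi = P + ln phi. *)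

Section DirectionalDerivative.
Context {R : realType} {V : normedModType R}.
Implicit Types (F : V -> R) (x u v : V).
Local Open Scope classical_set_scope.

Lemma is_derive_lineP F x v (t d : R) :
  is_derive (t *: v + x) v F d <-> is_derive t 1 (fun h => F (h *: v + x)) d.
Proof.
have quotientE :
    (fun h : R => h^-1 *: ((F \o shift (t *: v + x)) (h *: v) - F (t *: v + x))) =
    (fun h : R => h^-1 *: (((fun h => F (h *: v + x)) \o shift t) (h *: 1)
       - F (t *: v + x))).
  by apply/funext => h /=; rewrite addrA -scalerDl [h *: 1]mulr1.
by split=> -[F_der derF]; (split; [move: F_der|move: derF]);
  rewrite /derivable /derive quotientE.
Qed.

Lemma is_derive_comp1 F x v (g : R -> R) (d d' : R) :
  is_derive x v F d -> is_derive (F x) 1 g d' ->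
  is_derive x v (fun y => g (F y)) (d' * d).
Proof.
move=> dF dg; rewrite -[x]add0r -(scale0r v); apply/is_derive_lineP.
apply: is_derive1_comp; first by rewrite scale0r add0r.
by apply/is_derive_lineP; rewrite scale0r add0r.
Qed.

Lemma is_derive_eq0_line F v :
  (forall x, is_derive x v F 0) -> forall (t : R) x, F (t *: v + x) = F x.
Proof.
move=> dF t x.
have := @is_derive_0_is_cst R (fun h => F (h *: v + x)) t 0.
by rewrite scale0r add0r; apply=> h; exact/is_derive_lineP.
Qed.

Lemma MVT_line F v x (h : R) : 0 < h -> (forall y, derivable F y v) ->
  exists2 s, 0 < s < h & F (h *: v + x) - F x = h * 'D_v F (s *: v + x).
Proof.
move=> h0 dF; pose G (t : R) := F (t *: v + x).
have dG (t : R) : is_derive t 1 G ('D_v F (t *: v + x)).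
  by apply/is_derive_lineP; exact: derivableP.
have [|s sh GE] := MVT h0 (fun t _ => dG t).
  apply: continuous_subspaceT => t.
  by apply/differentiable_continuous/derivable1_diffP; case: (dG t).
exists s => //; move: GE; rewrite /G scale0r add0r => ->.
by rewrite subr0 mulrC.
Qed.

Lemma MVT_parallelogram F u v x (h : R) : 0 < h ->
  (forall y, derivable F y u) -> (forall y, derivable ('D_u F) y v) ->
  exists s t, [/\ 0 < s < h, 0 < t < h &
    F (h *: u + (h *: v + x)) - F (h *: u + x) - F (h *: v + x) + F x =
    h * (h * 'D_v ('D_u F) (s *: u + (t *: v + x)))].
Proof.
move=> h0 dF ddF; pose G y := F (h *: v + y) - F y.
have dFv y : is_derive y u (fun z => F (h *: v + z)) ('D_u F (h *: v + y)).
  rewrite -[y in is_derive y]add0r -(scale0r u); apply/is_derive_lineP.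
  rewrite (_ : (fun _ => _) = fun k => F (k *: u + (h *: v + y))).
    by apply/is_derive_lineP; rewrite scale0r add0r; exact: derivableP.
  by apply/funext => k; rewrite addrCA.
have dG y : is_derive y u G ('D_u F (h *: v + y) - 'D_u F y).
  by apply: is_deriveB => //; exact: derivableP.
have [s sh GE] : exists2 s, 0 < s < h &
    G (h *: u + x) - G x = h * 'D_u G (s *: u + x).
  by apply: (MVT_line x h0) => y; case: (dG y).
have [t th DE] := MVT_line (s *: u + x) h0 ddF.
have [_ derG] := dG (s *: u + x).
exists s, t; split=> //; rewrite [_ *: u + (t *: _ + _)]addrCA -DE -derG -GE.
by rewrite /G [h *: v + (_ + _)]addrCA; ring.
Qed.

Lemma near_parallelogram (A : set V) u v x : nbhs x A ->
  \forall h \near (0 : R)^'+, forall s t, 0 < s < h -> 0 < t < h ->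
    A (s *: u + (t *: v + x)).
Proof.
move=> /nbhs_ballP[e /= e0 xeA].
have M0 : 0 < `|u| + `|v| + 1 by rewrite ltr_wpDl// addr_ge0.
near=> h => s t /andP[s0 sh] /andP[t0 th].
have heM : h * (`|u| + `|v| + 1) < e.
  by rewrite -ltr_pdivlMr//; near: h; apply: nbhs_right_lt; rewrite divr_gt0.
apply: xeA; rewrite -ball_normE /ball_/= addrA opprD addrCA subrr addr0 normrN.
apply: le_lt_trans heM; apply: le_trans (ler_normD _ _) _.
rewrite !normrZ !gtr0_norm//.
have su : s * `|u| <= h * `|u| by rewrite ler_wpM2r// ltW.
have tv : t * `|v| <= h * `|v| by rewrite ler_wpM2r// ltW.
by rewrite !mulrDr mulr1; lra.
Unshelve. all: by end_near. Qed.

(* Schwarz's theorem: both mixed derivatives are limits of the same second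
   difference quotient. *)
Lemma derive_comm F u v x :
  (forall y, derivable F y u) -> (forall y, derivable F y v) ->
  (forall y, derivable ('D_u F) y v) -> (forall y, derivable ('D_v F) y u) ->
  {for x, continuous ('D_v ('D_u F))} -> {for x, continuous ('D_u ('D_v F))} ->
  'D_v ('D_u F) x = 'D_u ('D_v F) x.
Proof.
move=> dFu dFv dFuv dFvu cuv cvu.
apply/eqP; rewrite -subr_eq0 -normr_le0; apply/ler_addgt0Pl => e e0.
have e20 : 0 < e / 2 by rewrite divr_gt0.
have /cvgrPdist_lt/(_ _ e20)/(near_parallelogram u v) near_uv := cuv.
have /cvgrPdist_lt/(_ _ e20)/(near_parallelogram v u) near_vu := cvu.
have [h [h0 [uv_close vu_close]]] :=
  filter_ex (filterI (nbhs_right_gt (0 : R)) (filterI near_uv near_vu)).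
have [s [t [sh th]]] := MVT_parallelogram x h0 dFu dFuv.
have [s' [t' [sh' th']]] := MVT_parallelogram x h0 dFv dFvu.
rewrite [h *: v + (_ + _)]addrCA [_ - F (h *: v + x) - _]addrAC => ->.
move=> /(mulfI (lt0r_neq0 h0))/(mulfI (lt0r_neq0 h0)) mixedE.
rewrite addr0 [e]splitr.
apply: le_trans (ler_distD ('D_v ('D_u F) (s *: u + (t *: v + x))) _ _) _.
apply: lerD; apply: ltW; first exact: uv_close.
by rewrite -mixedE distrC; exact: vu_close.
Qed.

End DirectionalDerivative.

Section SmoothFunctions.
Context {R : realType} {n : nat}.
Local Notation E := ('rV[R]_n).
Implicit Types (F G : E -> R) (i j : 'I_n) (x : E).

(* The closure of the smooth functions under the operations below is stable
   under partial derivatives, so all of it is smooth. *)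
Inductive smooth_closure : (E -> R) -> Prop :=
| SmoothBase F : smooth F -> smooth_closure F
| SmoothCst (c : R) : smooth_closure (fun=> c)
| SmoothAdd F G : smooth_closure F -> smooth_closure G ->
    smooth_closure (fun x => F x + G x)
| SmoothMul F G : smooth_closure F -> smooth_closure G ->
    smooth_closure (fun x => F x * G x)
| SmoothInv F : smooth_closure F -> (forall x, F x != 0) ->
    smooth_closure (fun x => (F x)^-1)
| SmoothExp F : smooth_closure F -> smooth_closure (fun x => expR (F x))
| SmoothLn F : smooth_closure F -> (forall x, 0 < F x) ->
    smooth_closure (fun x => ln (F x)).

Lemma smooth_continuous F : smooth F -> continuous F.
Proof. by move=> /(_ [::])[]. Qed.

Lemma smooth_is_derive F i x : smooth F -> is_derive x 'e_i F (pd i F x).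
Proof. by move=> sF; apply: derivableP; case: (sF [::]) => _; apply. Qed.

Lemma smooth_derivable F i x : smooth F -> derivable F x 'e_i.
Proof. by move=> sF; have [] := smooth_is_derive i x sF. Qed.

Lemma smooth_pd F i : smooth F -> smooth (pd i F).
Proof. by move=> sF s; have := sF (rcons s i); rewrite foldr_rcons. Qed.

Lemma smooth_closure_continuous F : smooth_closure F -> continuous F.
Proof.
elim=> {F} [F sF|c|F G _ cF _ cG|F G _ cF _ cG|F _ cF F0|F _ cF|F _ cF F0] x.
- exact: smooth_continuous.
- exact: cst_continuous.
- exact: (continuousD (cF x) (cG x)).
- exact: (continuousM (cF x) (cG x)).
- exact: (continuousV (F0 x) (cF x)).
- by apply: continuous_comp; [exact: cF|exact: continuous_expR].
- by apply: continuous_comp; [exact: cF|exact: continuous_ln].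
Qed.

Lemma smooth_closure_is_derive i F : smooth_closure F ->
  exists2 G, smooth_closure G & forall x, is_derive x 'e_i F (G x).
Proof.
elim=> {F} [F sF|c|F G _ [F' sF' dF] _ [G' sG' dG]
  |F G sF [F' sF' dF] sG [G' sG' dG]
  |F sF [F' sF' dF] F0|F sF [F' sF' dF]|F sF [F' sF' dF] F0].
- exists (pd i F); first exact/SmoothBase/smooth_pd.
  by move=> x; exact: smooth_is_derive.
- by exists (fun=> 0) => [|x]; [exact: SmoothCst|exact: is_derive_cst].
- exists (fun x => F' x + G' x); first exact: SmoothAdd.
  by move=> x; exact: is_deriveD.
- exists (fun x => F x * G' x + G x * F' x).
    by apply: SmoothAdd; apply: SmoothMul.
  by move=> x; exact: is_deriveM.
- exists (fun x => -1 * ((F x)^-1 * (F x)^-1) * F' x).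
    do 2?[apply: SmoothMul => //]; first exact: SmoothCst.
    by apply: SmoothMul; exact: SmoothInv.
  move=> x; case: (dF x) => dFx <-; split; first exact: derivableV.
  by rewrite deriveV// mulN1r -invfM.
- exists (fun x => expR (F x) * F' x).
    by apply: SmoothMul => //; exact: SmoothExp.
  by move=> x; exact: is_derive_comp1.
- exists (fun x => (F x)^-1 * F' x).
    by apply: SmoothMul => //; apply: SmoothInv => // x; rewrite gt_eqF.
  by move=> x; apply: is_derive_comp1; exact: is_derive1_ln.
Qed.

Lemma smooth_closure_smooth F : smooth_closure F -> smooth F.
Proof.
move=> sF s; suff sS : smooth_closure (foldr pd F s).
  split; first exact: smooth_closure_continuous.
  by move=> i x; have [G _ dG] := smooth_closure_is_derive i sS; case: (dG x).
elim: s => //= i s /(smooth_closure_is_derive i)[G sG dG].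
by rewrite (_ : pd i _ = G)//; apply/funext => x; case: (dG x).
Qed.

Lemma smooth_cst (c : R) : smooth (cst c : E -> R).
Proof. exact/smooth_closure_smooth/SmoothCst. Qed.

Lemma smoothD F G : smooth F -> smooth G -> smooth (fun x => F x + G x).
Proof.
by move=> sF sG; apply/smooth_closure_smooth/SmoothAdd; exact: SmoothBase.
Qed.

Lemma smoothM F G : smooth F -> smooth G -> smooth (fun x => F x * G x).
Proof.
by move=> sF sG; apply/smooth_closure_smooth/SmoothMul; exact: SmoothBase.
Qed.

Lemma smoothV F : smooth F -> (forall x, F x != 0) -> smooth (fun x => (F x)^-1).
Proof.
by move=> sF F0; apply/smooth_closure_smooth/SmoothInv => //; exact: SmoothBase.
Qed.

Lemma smooth_expR F : smooth F -> smooth (fun x => expR (F x)).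
Proof. by move=> sF; exact/smooth_closure_smooth/SmoothExp/SmoothBase. Qed.

Lemma smooth_ln F : smooth F -> (forall x, 0 < F x) -> smooth (fun x => ln (F x)).
Proof.
by move=> sF F0; apply/smooth_closure_smooth/SmoothLn => //; exact: SmoothBase.
Qed.

Lemma smoothN F : smooth F -> smooth (fun x => - F x).
Proof.
move=> sF; rewrite (_ : (fun _ => _) = fun x => -1 * F x).
  exact/smoothM/sF/smooth_cst.
by apply/funext => x; rewrite mulN1r.
Qed.

Lemma smoothX F p : smooth F -> smooth (fun x => F x ^+ p).
Proof.
move=> sF; elim: p => [|p sFp].
  by rewrite (_ : (fun _ => _) = fun=> 1); [exact: smooth_cst|exact/funext].
rewrite (_ : (fun _ => _) = fun x => F x * F x ^+ p); first exact: smoothM.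
by apply/funext => x; rewrite exprS.
Qed.

Lemma smooth_sum p (F : 'I_p -> E -> R) : (forall k, smooth (F k)) ->
  smooth (fun x => \sum_k F k x).
Proof.
move=> sF; rewrite (_ : (fun _ => _) = \sum_k F k); last first.
  by apply/funext => x; rewrite fct_sumE.
by elim/big_ind: _ => [|G H|//]; [exact: smooth_cst|exact: smoothD].
Qed.

Lemma pd_cst (c : R) i x : pd i (cst c) x = 0.
Proof. exact: derive_cst. Qed.

Lemma pdD F G i x : smooth F -> smooth G ->
  pd i (fun y => F y + G y) x = pd i F x + pd i G x.
Proof. by move=> sF sG; apply: deriveD; exact: smooth_derivable. Qed.

Lemma pdN F i x : smooth F -> pd i (fun y => - F y) x = - pd i F x.
Proof. by move=> sF; apply: deriveN; exact: smooth_derivable. Qed.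

Lemma pdM F G i x : smooth F -> smooth G ->
  pd i (fun y => F y * G y) x = F x * pd i G x + G x * pd i F x.
Proof. by move=> sF sG; apply: deriveM; exact: smooth_derivable. Qed.

Lemma pdZ (c : R) F i x : smooth F -> pd i (fun y => c * F y) x = c * pd i F x.
Proof.
move=> sF; apply: etrans (pdM i x (smooth_cst c) sF) _.
by rewrite pd_cst mulr0 addr0.
Qed.

Lemma pdX F p i x : smooth F ->
  pd i (fun y => F y ^+ p) x = p%:R * F x ^+ p.-1 * pd i F x.
Proof.
move=> sF; have -> : (fun y => F y ^+ p) = F ^+ p.
  by apply/funext => y; rewrite exprfctE.
by apply: deriveX; exact: smooth_derivable.
Qed.

Lemma pdV F i x : smooth F -> F x != 0 ->
  pd i (fun y => (F y)^-1) x = - (F x) ^- 2 * pd i F x.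
Proof. by move=> sF F0; apply: deriveV => //; exact: smooth_derivable. Qed.

Lemma pd_expR F i x : smooth F -> pd i (fun y => expR (F y)) x = expR (F x) * pd i F x.
Proof.
move=> sF; have dF := smooth_is_derive i x sF.
by have [_] := is_derive_comp1 dF (is_derive_expR (F x)).
Qed.

Lemma pd_sum p (F : 'I_p -> E -> R) i x : (forall k, smooth (F k)) ->
  pd i (fun y => \sum_k F k y) x = \sum_k pd i (F k) x.
Proof.
move=> sF; rewrite (_ : (fun _ => _) = \sum_k F k); last first.
  by apply/funext => y; rewrite fct_sumE.
by rewrite /pd derive_sum// => k; exact: smooth_derivable.
Qed.

Lemma pd_sum_sqr p (F : 'I_p -> E -> R) i x : (forall k, smooth (F k)) ->
  pd i (fun y => \sum_k F k y ^+ 2) x = 2 * \sum_k F k x * pd i (F k) x.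
Proof.
move=> sF; rewrite pd_sum => [|k]; last exact: smoothX.
by rewrite mulr_sumr; apply: eq_bigr => k _; rewrite pdX// expr1 mulrA.
Qed.

Lemma pd_comm F i j : smooth F -> pd i (pd j F) = pd j (pd i F).
Proof.
move=> sF; apply/funext => x.
apply: derive_comm => [y|y|y|y||].
- exact: smooth_derivable.
- exact: smooth_derivable.
- exact/smooth_derivable/smooth_pd.
- exact/smooth_derivable/smooth_pd.
- exact/smooth_continuous/smooth_pd/smooth_pd.
- exact/smooth_continuous/smooth_pd/smooth_pd.
Qed.

Lemma pd_eq0_depends_not_on F i : smooth F -> (forall x, pd i F x = 0) ->
  depends_not_on i F.
Proof.
move=> sF dF x y xy; have dF0 z : is_derive z 'e_i F 0.
  by rewrite -(dF z); exact: smooth_is_derive.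
rewrite -(is_derive_eq0_line dF0 (y 0 i - x 0 i) x).
congr F; apply/rowP => k; rewrite !mxE eqxx/=.
by have [->|/xy->] := eqVneq k i; rewrite ?mulr1 ?mulr0 ?subrK ?add0r.
Qed.

Lemma depends_not_on_pd_eq0 F i x : depends_not_on i F -> pd i F x = 0.
Proof.
move=> dF; suff [] : is_derive x 'e_i F 0 by [].
rewrite -[x]add0r -(scale0r 'e_i); apply/is_derive_lineP.
rewrite (_ : (fun _ => _) = cst (F x)); first exact: is_derive_cst.
apply/funext => h /=; apply: dF => k ki.
by rewrite !mxE eqxx (negPf ki) mulr0 add0r.
Qed.

Lemma pd_eq0_cst F : smooth F -> (forall i x, pd i F x = 0) ->
  forall x y, F x = F y.
Proof.
move=> sF dF x y.
pose overwrite (s : seq 'I_n) := \row_k (if k \in s then y 0 k else x 0 k) : E.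
have FoverwriteE s : F (overwrite s) = F x.
  elim: s => [|i s <-]; first by congr F; apply/rowP => k; rewrite mxE.
  apply: (pd_eq0_depends_not_on sF (dF i)) => k ki.
  by rewrite !mxE in_cons (negPf ki).
rewrite -(FoverwriteE (enum 'I_n)); congr F; apply/rowP => k.
by rewrite mxE mem_enum.
Qed.

End SmoothFunctions.

Section KroneckerSums.
Context {R : comPzRingType} {n : nat}.
Local Notation delta i j := ((i == j)%:R : R).

Lemma sum_delta (k : 'I_n) (F : 'I_n -> R) : \sum_(p < n) delta p k * F p = F k.
Proof.
rewrite (bigD1 k)//= eqxx mul1r big1 ?addr0// => p /negPf->.
by rewrite mul0r.
Qed.

(* The quadratic part of the curvature of a conformally flat metric, for the
   Christoffel symbols found in christoffel_conformal. *)
Lemma sum_conformal_christoffel_products (v : 'I_n -> R) (a b c d : 'I_n) :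
  \sum_(q < n) - (delta q c * v a + delta a c * v q - delta a q * v c) *
    - (delta d q * v b + delta b q * v d - delta b d * v q) =
  delta d c * v a * v b + delta b c * v a * v d + 2 * delta a c * v b * v d
  - delta a d * v b * v c - delta a b * v c * v d
  - delta a c * delta b d * \sum_(q < n) v q ^+ 2.
Proof.
pose w q := delta d q * v b + delta b q * v d - delta b d * v q.
rewrite (eq_bigr (fun q => delta q c * (v a * w q) + delta q a * (- v c * w q)
  + delta q d * (delta a c * v q * v b) + delta q b * (delta a c * v q * v d)
  + (- delta a c * delta b d) * v q ^+ 2)); last first.
  move=> q _; rewrite /w (eq_sym q a) (eq_sym q b) (eq_sym q d).
  move: (delta q c) (delta a q) (delta d q) (delta b q) (delta a c) (delta b d).
  by move=> *; ring.
rewrite !big_split/= !sum_delta -mulr_sumr /w (eq_sym b a) (eq_sym d a).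
move: (delta d c) (delta b c) (delta a c) (delta a d) (delta a b) (delta b d).
by move=> *; ring.
Qed.

End KroneckerSums.

Section KulkarniNomizu.
Context {R : realType} {n : nat}.
Implicit Types (h k : 'M[R]_n) (a b c d : 'I_n).

Lemma kulkarni_nomizuZl (t : R) h k a b c d :
  kulkarni_nomizu (t *: h) k a b c d = t * kulkarni_nomizu h k a b c d.
Proof. by rewrite /kulkarni_nomizu !mxE; ring. Qed.

Lemma kulkarni_nomizu1_diag h a b : a != b ->
  kulkarni_nomizu h 1%:M a b a b = h a a + h b b.
Proof.
move=> ab; rewrite /kulkarni_nomizu !mxE !eqxx (eq_sym b a) (negPf ab).
by rewrite !mulr0 !mulr1 !subr0.
Qed.

Lemma kulkarni_nomizu1_offdiag h a b d : b != a -> b != d -> a != d ->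
  kulkarni_nomizu h 1%:M a b b d = - h a d.
Proof.
move=> ba bd ad; rewrite /kulkarni_nomizu !mxE eqxx (eq_sym a b).
by rewrite (negPf ba) (negPf bd) (negPf ad) !mulr0 mulr1 subr0 !add0r.
Qed.

Lemma exists_ord_neq2 a b : (3 <= n)%N -> exists2 c, c != a & c != b.
Proof.
move=> n_ge3; have : (0 < #|~: [set a; b]|)%N.
  rewrite cardsCs finset.setCK card_ord subn_gt0 (leq_ltn_trans _ n_ge3)// cards2.
  by case: (_ == _).
by case/card_gt0P => c; rewrite !inE negb_or => /andP[ca cb]; exists c.
Qed.

Lemma kulkarni_nomizu1_inj h k : (3 <= n)%N ->
  (forall a b c d, kulkarni_nomizu h 1%:M a b c d = kulkarni_nomizu k 1%:M a b c d) ->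
  h = k.
Proof.
move=> n_ge3 hkE; apply/matrixP => i j; have [<-{j}|ij] := eqVneq i j.
  have [p pi _] := exists_ord_neq2 i i n_ge3.
  have [q qi qp] := exists_ord_neq2 i p n_ge3.
  have diag_sum a b : a != b -> h a a + h b b = k a a + k b b.
    by move=> ab; rewrite -!kulkarni_nomizu1_diag.
  by have := diag_sum _ _ pi; have := diag_sum _ _ qi; have := diag_sum _ _ qp; lra.
have [b bi bj] := exists_ord_neq2 i j n_ge3.
by apply: oppr_inj; rewrite -!(@kulkarni_nomizu1_offdiag _ _ b).
Qed.

End KulkarniNomizu.

Section ConformalCurvature.
Context {R : realType} {n : nat}.
Local Notation E := ('rV[R]_n).
Local Notation delta i j := ((i == j)%:R : R).
Implicit Types (phi : E -> R) (i j k : 'I_n) (x : E).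

Definition logder phi i x : R := pd i phi x / phi x.

Definition schouten phi x : 'M[R]_n :=
  \matrix_(i, j) (pd i (logder phi j) x + logder phi i x * logder phi j x
    - delta i j / 2 * \sum_(k < n) logder phi k x ^+ 2).

Variable phi : E -> R.
Hypotheses (phi_smooth : smooth phi) (phi_neq0 : forall x, phi x != 0).

Lemma smooth_logder i : smooth (logder phi i).
Proof. by apply: smoothM; [exact: smooth_pd|exact: smoothV]. Qed.

Lemma pd_logder i j x :
  pd i (logder phi j) x = pd i (pd j phi) x / phi x - logder phi i x * logder phi j x.
Proof.
rewrite pdM; [|exact: smooth_pd|exact: smoothV].
rewrite (pdV i phi_smooth (phi_neq0 x)).
rewrite /logder; have := phi_neq0 x.
by move: (phi x) (pd i phi x) (pd j phi x) (pd i _ x) => *; field.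
Qed.

Lemma pd_logder_comm i j : pd i (logder phi j) = pd j (logder phi i).
Proof.
apply/funext => x; rewrite !pd_logder (pd_comm i j phi_smooth).
by move: (logder phi) => v; rewrite (mulrC (v i x)).
Qed.

Lemma schoutenE x i j : schouten phi x i j =
  pd i (pd j phi) x / phi x - delta i j / 2 * \sum_(k < n) logder phi k x ^+ 2.
Proof. by rewrite mxE pd_logder subrK. Qed.

Lemma conformalE x i j : conformal phi x i j = delta i j * (phi x ^+ 2)^-1.
Proof. by rewrite !mxE div1r mulrC. Qed.

Lemma pd_conformal i j k x :
  pd i (fun y => conformal phi y j k) x =
  - 2 * delta j k * logder phi i x * phi x ^- 2.
Proof.
have phi2_neq0 y : phi y ^+ 2 != 0 by rewrite expf_neq0.
under [fun y => _]funext do rewrite conformalE.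
have phi2_smooth := smoothX 2 phi_smooth.
rewrite pdZ; last exact: smoothV.
rewrite (pdV i phi2_smooth (phi2_neq0 x)) (pdX 2 i x phi_smooth).
rewrite /logder /=; have := phi_neq0 x.
by move: (phi x) (pd i phi x) (delta j k) => *; field.
Qed.

Lemma christoffel_conformal k i j :
  christoffel (conformal phi) k i j = fun x =>
  - (delta j k * logder phi i x + delta i k * logder phi j x
     - delta i j * logder phi k x).
Proof.
apply/funext => x; rewrite /christoffel /conformal div1r scalemx1.
rewrite invmx_scalar invrK.
under eq_bigr => p _.
  rewrite mxE !pd_conformal -[_ *+ (k == p)]mulr_natl (eq_sym k p) -mulrA.
  over.
rewrite sum_delta; have := phi_neq0 x.
move: (phi x) (logder phi i x) (logder phi j x) (logder phi k x).
by move: (delta j k) (delta i k) (delta i j) => *; field.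
Qed.

Lemma pd_christoffel_conformal l k i j x :
  pd l (christoffel (conformal phi) k i j) x =
  - (delta j k * pd l (logder phi i) x + delta i k * pd l (logder phi j) x
     - delta i j * pd l (logder phi k) x).
Proof.
(* An abstract v keeps rewriting from unfolding the derivatives in logder. *)
rewrite christoffel_conformal; move: (logder phi) smooth_logder => v v_smooth.
have smoothZ (c : R) p : smooth (fun y => c * v p y).
  exact/smoothM/v_smooth/smooth_cst.
have smooth_sum2 := smoothD (smoothZ (delta j k) i) (smoothZ (delta i k) j).
have smooth_opp := smoothN (smoothZ (delta i j) k).
rewrite (pdN l x (smoothD smooth_sum2 smooth_opp)) (pdD l x smooth_sum2 smooth_opp).
rewrite (pdD l x (smoothZ _ i) (smoothZ _ j)) (pdN l x (smoothZ _ k)).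
by rewrite !(pdZ _ l x (v_smooth _)).
Qed.

Lemma curvature_endo_conformal x a b c d :
  curvature_endo (conformal phi) a b d c x =
  kulkarni_nomizu (schouten phi x) 1%:M a b c d.
Proof.
have quadratic := sum_conformal_christoffel_products (logder phi ^~ x).
rewrite /curvature_endo !pd_christoffel_conformal.
under eq_bigr do rewrite !christoffel_conformal.
rewrite big_split/= sumrN !quadratic.
have oneE i j : (1%:M : 'M[R]_n) i j = delta i j by rewrite mxE.
rewrite /kulkarni_nomizu !oneE ![schouten _ _ _ _]mxE (eq_sym b a).
move: (logder phi) (pd_logder_comm b a) => v ->.
move: (\sum_(k < n) v k x ^+ 2) (v a x) (v b x) (v c x) (v d x).
move: (delta d c) (delta b c) (delta b d) (delta a c) (delta a d) (delta a b).
move: (pd a (v b) x) (pd a (v c) x) (pd a (v d) x) (pd b (v c) x) (pd b (v d) x).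
by move=> *; field.
Qed.

Lemma riemann_conformal x a b c d :
  riemann (conformal phi) x a b c d =
  phi x ^- 2 * kulkarni_nomizu (schouten phi x) 1%:M a b c d.
Proof.
rewrite /riemann.
under eq_bigr do rewrite conformalE (eq_sym c) -mulrA.
by rewrite sum_delta curvature_endo_conformal.
Qed.

Lemma riemann_conformal_eq_kulkarni_nomizu (T : 'M[R]_n) x : (3 <= n)%N ->
  (forall a b c d,
     riemann (conformal phi) x a b c d = kulkarni_nomizu T 1%:M a b c d) <->
  schouten phi x = phi x ^+ 2 *: T.
Proof.
move=> n_ge3; have phi2_neq0 : phi x ^+ 2 != 0 by rewrite expf_neq0.
split=> [RT|ST a b c d]; last first.
  by rewrite riemann_conformal ST kulkarni_nomizuZl mulKf.
apply: kulkarni_nomizu1_inj => // a b c d.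
by rewrite kulkarni_nomizuZl -RT riemann_conformal mulVKf.
Qed.

End ConformalCurvature.

Section SchoutenEquation.
Context {R : realType} {n : nat}.
Local Notation E := ('rV[R]_n).
Variables (f : 'I_n -> E -> R) (phi : E -> R).
Hypotheses (phi_smooth : smooth phi) (phi_neq0 : forall x, phi x != 0).
Implicit Types (i j k : 'I_n) (x : E).

Definition schouten_equation : Prop :=
  forall x, schouten phi x = phi x ^+ 2 *: diag_tensor f x.

Lemma schouten_equation_offdiag i j x : schouten_equation -> i != j ->
  pd i (pd j phi) x = 0.
Proof.
move=> Sf ij; have /matrixP/(_ i j) := Sf x.
rewrite schoutenE// !mxE (negPf ij) !mul0r subr0 mulr0 => /eqP.
by rewrite mulf_eq0 invr_eq0 (negPf (phi_neq0 x)) orbF => /eqP.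
Qed.

Lemma schouten_equation_diag i x : schouten_equation ->
  phi x * pd i (pd i phi) x =
  f i x * phi x ^+ 4 + 2^-1 * \sum_(k < n) pd k phi x ^+ 2.
Proof.
move=> Sf; have /matrixP/(_ i i) := Sf x; rewrite schoutenE// !mxE eqxx mul1r.
under eq_bigr do rewrite expr_div_n.
rewrite -mulr_suml => SfE; have := phi_neq0 x; move: SfE.
move: (phi x) (pd i (pd i phi) x) (\sum_(k < n) _) (f i x) => p pii N fi SfE p0.
have -> : pii = p * (p ^+ 2 * fi + 2^-1 * (N / p ^+ 2)).
  by rewrite -SfE; field.
by field.
Qed.

Lemma pd_schouten_equation_diag i j x : schouten_equation -> smooth (f i) ->
  i != j ->
  pd j phi x * pd i (pd i phi) x =
  f i x * (4 * phi x ^+ 3 * pd j phi x) + phi x ^+ 4 * pd j (f i) x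
  + pd j phi x * pd j (pd j phi) x.
Proof.
move=> Sf f_smooth ij.
(* phi_{,iij} = (phi_{,ij})_{,i} *)
have pd3_eq0 : pd j (pd i (pd i phi)) x = 0.
  rewrite pd_comm; last exact: smooth_pd.
  rewrite (_ : pd j (pd i phi) = cst 0) ?pd_cst//.
  by apply/funext => y; apply: schouten_equation_offdiag; rewrite // eq_sym.
have [N [N_smooth dN diagE]] : exists N, [/\ smooth N,
    pd j N x = 2 * (pd j phi x * pd j (pd j phi) x) &
    (fun y => phi y * pd i (pd i phi) y) = fun y => f i y * phi y ^+ 4 + 2^-1 * N y].
  exists (fun y => \sum_(k < n) pd k phi y ^+ 2); split.
  - by apply: smooth_sum => k; exact/smoothX/smooth_pd.
  - rewrite pd_sum_sqr => [|k]; last exact: smooth_pd.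
    rewrite (bigD1 j)//= big1 ?addr0// => k kj.
    by rewrite schouten_equation_offdiag ?mulr0// eq_sym.
  - by apply/funext => y; exact: schouten_equation_diag.
have := congr1 (fun F => pd j F x) diagE.
move: (pd i (pd i phi)) (smooth_pd i (smooth_pd i phi_smooth)) pd3_eq0.
move=> u u_smooth du; have phi4_smooth := smoothX 4 phi_smooth.
have N2_smooth := smoothM (smooth_cst (2^-1 : R)) N_smooth.
rewrite (pdM j x phi_smooth u_smooth) du mulr0 add0r mulrC => ->.
rewrite (pdD j x (smoothM f_smooth phi4_smooth) N2_smooth) (pdZ _ j x N_smooth) dN.
rewrite (pdM j x f_smooth phi4_smooth) (pdX 4 j x phi_smooth).
by rewrite mulKf.
Qed.

Definition quo_logder : Prop :=
  forall i j, i != j -> forall x, quo f i j x = - logder phi j x.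

Definition nondegenerate : Prop :=
  forall i j, i != j -> forall x, 3 * f i x + f j x != 0.

Lemma schouten_equation_quo_logder : (forall i, smooth (f i)) ->
  nondegenerate -> schouten_equation -> quo_logder.
Proof.
move=> f_smooth f_nondeg Sf i j ij x; rewrite /quo /logder.
have := pd_schouten_equation_diag x Sf (f_smooth i) ij.
have := schouten_equation_diag i x Sf; have := schouten_equation_diag j x Sf.
have := f_nondeg _ _ ij x; have := phi_neq0 x.
move: (pd j (f i) x) (pd i (pd i phi) x) (pd j (pd j phi) x) => fij pii pjj.
move: (\sum_(k < n) _) (pd j phi x) (phi x) (f i x) (f j x) => N pj p fi fj.
move=> p0 nondeg pjjE piiE diffE; apply/eqP; rewrite -mulNr eqr_div//; apply/eqP.
have pii_pjj : p * (pii - pjj) = p ^+ 4 * (fi - fj) by rewrite mulrBr piiE pjjE; ring.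
apply: (mulfI (expf_neq0 4 p0)).
have -> : p ^+ 4 * (fij * p) = p * (p ^+ 4 * fij) by ring.
have -> : p ^+ 4 * fij = pj * (pii - pjj) - 4 * p ^+ 3 * pj * fi.
  by rewrite mulrBr diffE; ring.
by rewrite mulrBr [p * (pj * _)]mulrCA pii_pjj; ring.
Qed.

Lemma schouten_equationP : schouten_equation <->
  (forall i j x, i != j ->
     pd i (logder phi j) x = - (logder phi i x * logder phi j x)) /\
  (forall i x, pd i (logder phi i) x + 2^-1 * logder phi i x ^+ 2
     - 2^-1 * \sum_(k < n | k != i) logder phi k x ^+ 2 = f i x * phi x ^+ 2).
Proof.
have schouten_diag i x : schouten phi x i i =
    pd i (logder phi i) x + 2^-1 * logder phi i x ^+ 2
    - 2^-1 * \sum_(k < n | k != i) logder phi k x ^+ 2.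
  rewrite mxE eqxx (bigD1 i)//=; move: (\sum_(k < n | _) _) => N.
  by move: (logder phi i x) (pd i _ x) => v dv; field.
have schouten_offdiag i j x : i != j -> schouten phi x i j =
    pd i (logder phi j) x + logder phi i x * logder phi j x.
  by move=> /negPf ij; rewrite mxE ij !mul0r subr0.
split=> [Sf|[offdiag diag] x].
  split=> [i j x ij|i x]; have /matrixP := Sf x.
    move=> /(_ i j); rewrite schouten_offdiag// !mxE (negPf ij) mulr0 => /eqP.
    by rewrite addr_eq0 => /eqP.
  by move=> /(_ i i); rewrite schouten_diag !mxE eqxx [RHS]mulrC.
apply/matrixP => i j; have [<-|ij] := eqVneq i j.
  by rewrite schouten_diag diag !mxE eqxx [RHS]mulrC.
by rewrite schouten_offdiag// offdiag// addNr !mxE (negPf ij) mulr0.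
Qed.

Lemma pd_quo_logder k i j x : quo_logder -> i != j ->
  pd k (quo f i j) x = - pd k (logder phi j) x.
Proof.
move=> qE ij; rewrite -(pdN k x (smooth_logder phi_smooth phi_neq0 j)).
by congr (pd k _ x); apply/funext => y; exact: qE.
Qed.

Lemma pd_quo_comm i j k l x : quo_logder -> j != i -> l != k ->
  pd k (quo f j i) x = pd i (quo f l k) x.
Proof.
move=> qE ji lk; apply: etrans (pd_quo_logder k x qE ji) _.
rewrite (pd_logder_comm phi_smooth phi_neq0 k i).
exact: esym (pd_quo_logder i x qE lk).
Qed.

Lemma pde_systemP (ell : 'I_n -> 'I_n) : (forall k, ell k != k) -> quo_logder ->
  pde_system f (fun i x => f i x * phi x ^+ 2) <-> schouten_equation.
Proof.
move=> ell_neq qE; rewrite schouten_equationP.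
have sum_quo (e : 'I_n -> 'I_n) i x : (forall k, e k != k) ->
    \sum_(k < n | k != i) quo f (e k) k x ^+ 2 =
    \sum_(k < n | k != i) logder phi k x ^+ 2.
  by move=> e_neq; apply: eq_bigr => k _; rewrite qE// sqrrN.
split=> [[_ _ _ diag offdiag]|[offdiag diag]].
  split=> [i j x ij|i x].
    have := offdiag i j ij x; rewrite !qE// 1?eq_sym// mulrNN.
    by rewrite pd_quo_logder// => ->; rewrite opprK.
  have := diag ell ell_neq i (ell i); rewrite eq_sym => /(_ (ell_neq i) x) <-.
  by rewrite sum_quo// qE// sqrrN pd_quo_logder// opprK div1r [X in _ = X - _]addrC.
split=> [i j k ij kj x|i j k ij kj x|i j ij x|e e_neq i j ij x|i j ij x].
- by rewrite !qE.
- by apply: pd_quo_comm; rewrite // eq_sym.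
- by apply: pd_quo_comm; rewrite // eq_sym.
- have ji : j != i by rewrite eq_sym.
  by rewrite sum_quo// qE// sqrrN pd_quo_logder// opprK div1r -diag [X in X - _]addrC.
- have ji : j != i by rewrite eq_sym.
  by rewrite !qE// mulrNN pd_quo_logder// offdiag// opprK.
Qed.

End SchoutenEquation.

Section ConformalFactor.
Context {R : realType} {n : nat}.
Local Notation E := ('rV[R]_n).
Implicit Types (f : 'I_n -> E -> R) (phi chi P psi : E -> R) (i j k m l : 'I_n).

Lemma conformal_solutionP f phi : (3 <= n)%N ->
  conformal_solution f phi <->
  [/\ smooth phi, forall x, 0 < phi x & schouten_equation f phi].
Proof.
move=> n_ge3; suff Rf : smooth phi -> (forall x, 0 < phi x) -> forall x,
    (forall a b c d, riemann (conformal phi) x a b c d =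
       kulkarni_nomizu (diag_tensor f x) 1%:M a b c d) <->
    schouten phi x = phi x ^+ 2 *: diag_tensor f x.
  by split=> -[phi_smooth phi_gt0 eq_phi]; split=> // x; apply/Rf.
move=> phi_smooth phi_gt0 x; apply: riemann_conformal_eq_kulkarni_nomizu => //.
by move=> y; rewrite gt_eqF.
Qed.

Lemma conformal_solution_quo_logder f phi : (3 <= n)%N ->
  (forall i, smooth (f i)) -> nondegenerate f ->
  conformal_solution f phi -> quo_logder f phi.
Proof.
move=> n_ge3 f_smooth f_nondeg /(conformal_solutionP _ _ n_ge3)[phi_smooth phi_gt0 Sf].
by apply: schouten_equation_quo_logder => // x; rewrite gt_eqF.
Qed.

Lemma logder_eq_proportional phi chi : smooth phi -> smooth chi ->
  (forall x, phi x != 0) -> (forall x, chi x != 0) ->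
  (forall i x, logder phi i x = logder chi i x) ->
  forall x, phi x = phi 0 / chi 0 * chi x.
Proof.
move=> phi_smooth chi_smooth phi_neq0 chi_neq0 logderE x.
have chiV_smooth := smoothV chi_smooth chi_neq0.
have quotient_cst : phi x / chi x = phi 0 / chi 0.
  apply: (pd_eq0_cst (smoothM phi_smooth chiV_smooth)) => i y.
  rewrite (pdM i y phi_smooth chiV_smooth) (pdV i chi_smooth (chi_neq0 y)).
  have := logderE i y; have := phi_neq0 y; have := chi_neq0 y; rewrite /logder.
  move: (phi y) (chi y) (pd i phi y) (pd i chi y) => p c dp dc c0 p0.
  by move=> /(canRL (divfK p0)) ->; field; rewrite c0.
by rewrite -quotient_cst divfK.
Qed.

Lemma phi_of_gt0 P psi x : 0 < phi_of P psi x.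
Proof. exact: expR_gt0. Qed.

Lemma phi_of_neq0 P psi x : phi_of P psi x != 0.
Proof. by rewrite gt_eqF// phi_of_gt0. Qed.

Lemma smooth_phi_of P psi : smooth P -> smooth psi -> smooth (phi_of P psi).
Proof.
by move=> P_smooth psi_smooth; exact/smooth_expR/smoothD/psi_smooth/smoothN.
Qed.

Lemma logder_phi_of P psi i x : smooth P -> smooth psi ->
  logder (phi_of P psi) i x = pd i psi x - pd i P x.
Proof.
move=> P_smooth psi_smooth; have NP_smooth := smoothN P_smooth; rewrite /logder.
rewrite [pd i _ x](pd_expR i x (smoothD NP_smooth psi_smooth)).
rewrite (pdD i x NP_smooth psi_smooth) (pdN i x P_smooth).
by rewrite mulrC mulKf ?phi_of_neq0// addrC.
Qed.

Lemma phi_of_addln P phi : (forall x, 0 < phi x) ->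
  phi_of P (fun x => P x + ln (phi x)) = phi.
Proof.
by move=> phi_gt0; apply/funext => x; rewrite /phi_of addKr lnK// posrE.
Qed.

Lemma h_ofE f P psi : h_of f P psi = fun i x => f i x * phi_of P psi x ^+ 2.
Proof. by apply/funext => i; apply/funext => x; rewrite /h_of /phi_of -expRM_natl. Qed.

Definition other_index m l k : 'I_n := if k == m then l else m.

Lemma other_index_neq m l k : l != m -> other_index m l k != k.
Proof. by rewrite /other_index; case: (eqVneq k m) => [->//|]; rewrite eq_sym. Qed.

End ConformalFactor.

Section PsiCondition.
Context {R : realType} {n : nat}.
Local Notation E := ('rV[R]_n).
Variables (f : 'I_n -> E -> R) (m l : 'I_n) (P : E -> R).
Hypotheses (neq_lm : l != m) (P_smooth : smooth P).
Hypothesis P_prim : forall x, pd m P x = quo f l m x.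
Implicit Types (phi psi : E -> R) (h : 'I_n -> E -> R) (i j : 'I_n).

Lemma psi_conditionP psi : psi_condition f m P psi <->
  smooth psi /\
  forall j x, logder (phi_of P psi) j x = - quo f (other_index m l j) j x.
Proof.
rewrite /other_index; split=> [[psi_smooth psi_m dpsi]|[psi_smooth logderE]].
  split=> // j x; rewrite logder_phi_of//; case: (eqVneq j m) => [->|jm].
    by rewrite P_prim (depends_not_on_pd_eq0 x psi_m) add0r.
  by rewrite dpsi// addrAC subrr add0r.
split=> // [|i im x].
  apply: pd_eq0_depends_not_on => // x; have := logderE m x.
  by rewrite logder_phi_of// eqxx P_prim => /(canRL (subrK _)) ->; rewrite addNr.
have := logderE i x; rewrite logder_phi_of// (negPf im) => /(canRL (subrK _)) ->.
by rewrite addrC.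
Qed.

Lemma quo_logder_psi_condition phi : smooth phi -> (forall x, 0 < phi x) ->
  quo_logder f phi -> psi_condition f m P (fun x => P x + ln (phi x)).
Proof.
move=> phi_smooth phi_gt0 quoE; apply/psi_conditionP; split.
  exact/smoothD/smooth_ln.
by move=> j x; rewrite phi_of_addln// quoE ?opprK// other_index_neq.
Qed.

Lemma psi_condition_quo_logder psi h : psi_condition f m P psi ->
  pde_system f h -> quo_logder f (phi_of P psi).
Proof.
move=> /psi_conditionP[_ logderE] [quoE _ _ _ _] i j ij x.
by rewrite logderE opprK; apply: quoE => //; exact: other_index_neq.
Qed.

Hypotheses (n_ge3 : (3 <= n)%N) (f_smooth : forall i, smooth (f i)).
Hypothesis f_nondeg : nondegenerate f.

Lemma conformal_solution_phi_ofP psi : psi_condition f m P psi ->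
  pde_system f (h_of f P psi) <-> conformal_solution f (phi_of P psi).
Proof.
move=> psiC; have [psi_smooth _ _] := psiC.
have phi_smooth := smooth_phi_of P_smooth psi_smooth.
have systemP := pde_systemP phi_smooth (phi_of_neq0 P psi)
  (fun k => other_index_neq k neq_lm).
rewrite h_ofE; split=> [sys|phiC].
  apply/conformal_solutionP => //; split=> //; first exact: phi_of_gt0.
  by apply/systemP => //; exact: psi_condition_quo_logder sys.
apply/systemP; first exact: conformal_solution_quo_logder phiC.
by have /(conformal_solutionP _ _ n_ge3)[] := phiC.
Qed.

Lemma conformal_solution_proportional phi psi :
  psi_condition f m P psi -> conformal_solution f phi ->
  forall x, phi x = phi 0 / phi_of P psi 0 * phi_of P psi x.
Proof.
move=> /psi_conditionP[psi_smooth logderE] phiC; have [phi_smooth phi_gt0 _] := phiC.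
have phi_of_smooth := smooth_phi_of P_smooth psi_smooth.
apply: (logder_eq_proportional phi_smooth phi_of_smooth _ (phi_of_neq0 P psi)).
  by move=> x; rewrite gt_eqF.
move=> i x; rewrite logderE.
rewrite (conformal_solution_quo_logder n_ge3 f_smooth f_nondeg phiC).
  by rewrite opprK.
exact: other_index_neq.
Qed.

End PsiCondition.

Theorem theorem3p2 (R : realType) (n : nat) (hn : (3 <= n)%N)
  (f : 'I_n -> 'rV[R]_n -> R)
  (f_smooth : forall i, smooth (f i))
  (f_nondeg : forall i j, i != j -> forall x, 3 * f i x + f j x != 0)
  (m l : 'I_n) (hlm : l != m)
  (P : 'rV[R]_n -> R) (P_smooth : smooth P)
  (P_prim : forall x, pd m P x = quo f l m x) :
  ((exists phi, conformal_solution f phi) <->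
   (exists psi, psi_condition f m P psi /\ pde_system f (h_of f P psi)))
  /\
  (forall psi, psi_condition f m P psi ->
     (pde_system f (h_of f P psi) -> conformal_solution f (phi_of P psi)) /\
     (forall phi, conformal_solution f phi ->
        exists2 c : R, 0 < c & forall x, phi x = c * phi_of P psi x)).
Proof.
have solutionP := conformal_solution_phi_ofP hlm P_smooth P_prim hn f_smooth f_nondeg.
split; first split=> [[phi phiC]|[psi [psiC sys]]].
- have [phi_smooth phi_gt0 _] := phiC.
  have quoE := conformal_solution_quo_logder hn f_smooth f_nondeg phiC.
  have psiC := quo_logder_psi_condition hlm P_smooth P_prim phi_smooth phi_gt0 quoE.
  exists (fun x => P x + ln (phi x)); split=> //.
  by apply/solutionP; rewrite ?phi_of_addln.
- by exists (phi_of P psi); exact/solutionP.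
- move=> psi psiC; split=> [|phi phiC]; first exact: (solutionP psi psiC).1.
  have [_ phi_gt0 _] := phiC.
  exists (phi 0 / phi_of P psi 0); first by rewrite divr_gt0// phi_of_gt0.
  exact: (conformal_solution_proportional hlm P_smooth P_prim hn f_smooth f_nondeg).
Qed.
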